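(* Let $q=p^\beta=ef+1$ be a prime power with $e,f>1$, and suppose $C_0^e$ is a proper $(q,f,\lambda,\mu)$-partial difference set. Then (i) if $e>f$, $C_0^e\cup\{0\}$ is a subfield of $GF(q)$; (ii) if $e<f$, $C_0^e\cup\{0\}$ is not a subfield of $GF(q)$ and $\mu\ge1$; (iii) the case $e=f$ cannot occur for $f>2$.
   Context: $\alpha$ is a primitive element of $GF(q)$ and $C_0^e=\langle\alpha^e\rangle$. A subset $P\subseteq GF(q)$ with $|P|=k$ is a $(q,k,\lambda,\mu)$-partial difference set if the multiset $\{x-y:x,y\in P,x\neq y\}$ consists of $\lambda$ copies of each element of $P$ and $\mu$ copies of each element of $GF(q)\setminus(P\cup\{0\})$; it is proper if $\lambda\neq\mu$. *)

(* Defs.v *)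
From HB Require Import structures.
From mathcomp Require Import all_boot all_order all_algebra all_fingroup all_solvable all_field.

Set Implicit Arguments.
Unset Strict Implicit.
Unset Printing Implicit Defensive.

Import GRing.Theory.
Local Open Scope ring_scope.

(* The multiplicity of d in the multiset {x - y : x, y in P, x <> y}. *)
Definition diff_mult (F : finFieldType) (P : {set F}) (d : F) : nat :=
  #|[set z in setX P P | (z.1 != z.2) && (z.1 - z.2 == d)]|.

(* No clause is needed for the difference 0 when 0 is not in P: its
   multiplicity is 0 by definition of diff_mult. *)
Definition partial_difference_set (F : finFieldType) (q k lambda mu : nat)
    (P : {set F}) : Prop :=
  [/\ #|F| = q,
      #|P| = k,
      forall d : F, d \in P -> diff_mult P d = lambda
    & forall d : F, d \notin P :|: [set 0] -> diff_mult P d = mu].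

Definition proper_partial_difference_set (F : finFieldType)
    (q k lambda mu : nat) (P : {set F}) : Prop :=
  partial_difference_set q k lambda mu P /\ lambda <> mu.

Definition primitive_element (F : finFieldType) (alpha : {unit F}) : Prop :=
  <[alpha]>%g = [set: {unit F}].

(* The cyclotomic class C_0^e: the subgroup <alpha^e> of the multiplicative
   group, as a set of field elements. *)
Definition cyclotomic_class0 (F : finFieldType) (alpha : {unit F}) (e : nat)
    : {set F} :=
  [set FinRing.uval u | u in <[(alpha ^+ e)%g]>%g].

(* divring_closed S: 1 is in S, and S is closed under x - y and x / y. *)
Definition is_subfield (F : finFieldType) (S : {set F}) : Prop :=
  GRing.divring_closed S.

(* Main.v *)
Require Import Defs.
From HB Require Import structures.
From mathcomp Require Import all_boot all_order all_algebra all_fingroup all_solvable all_field.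
From mathcomp Require Import zify.

Set Implicit Arguments.
Unset Strict Implicit.
Unset Printing Implicit Defensive.

Import GRing.Theory.
Local Open Scope ring_scope.

(** Write [P] for [C_0^e].  Counting the ordered pairs of distinct elements of
    [P] gives [f - 1 = lambda + (e - 1) mu].  If [mu = 0] then every nonzero
    difference of elements of [P] lies in [P], so [P] with [0] is a subfield;
    a proper subfield of order [f + 1] forces [(f + 1)^2 <= q], hence [f < e].
    If [e > f] the count forces [mu = 0].  If [e = f] it forces [mu = 0], which
    is excluded, or [lambda = 0] and [mu = 1].  In the latter case [P = - P],
    because [d] and [- d] have the same multiplicity, and then [x - y] and
    [(- y) - (- x)] represent the same difference, against [mu = 1], as soon as
    [P] has an element [y] other than [x] and [- x]. *)

Lemma diff_mult0 (F : finFieldType) (P : {set F}) : diff_mult P 0 = 0%N.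
Proof.
apply/eqP; rewrite cards_eq0; apply/eqP/setP => -[x y].
by rewrite !inE /= subr_eq0; case: eqP; rewrite ?andbF.
Qed.

(** Swapping the two coordinates matches the pairs with difference [d] to those with difference
    [- d]. *)
Lemma diff_multN (F : finFieldType) (P : {set F}) (d : F) :
  diff_mult P (- d) = diff_mult P d.
Proof.
have swapK : cancel (fun z : F * F => (z.2, z.1)) (fun z => (z.2, z.1)) by case.
rewrite /diff_mult -(card_imset _ (can_inj swapK)).
apply: eq_card => -[x y]; rewrite (can_imset_pre _ swapK) !inE /=.
by rewrite [y == x]eq_sym -[y - x]opprB eqr_opp [(y \in P) && _]andbC.
Qed.

(** The off-diagonal pairs of [P * P] are sorted by their difference; the summand [#|P|] accounts
    for the diagonal. *)
Lemma sum_diff_mult (F : finFieldType) (P : {set F}) :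
  ((\sum_d diff_mult P d) + #|P| = #|P| * #|P|)%N.
Proof.
rewrite -cardsX -[RHS]sum1_card [RHS](bigID (fun z : F * F => z.1 != z.2)) /=; congr addn.
  rewrite [RHS](partition_big (fun z : F * F => z.1 - z.2) predT) //=.
  apply: eq_bigr => d _; rewrite /diff_mult -sum1_card.
  by apply: eq_bigl => z; rewrite !inE andbA.
rewrite sum1dep_card.
have diag_inj : injective (fun x : F => (x, x)) by move=> x y [].
rewrite -(card_imset _ diag_inj); apply: eq_card => -[x y]; rewrite !inE /=.
apply/imsetP/idP => [[z zP [-> ->]]|/andP[/andP[xP _]]].
  by rewrite zP eqxx.
by rewrite negbK => /eqP <-; exists x.
Qed.

Lemma diff_mult_gt0 (F : finFieldType) (P : {set F}) (x y : F) :
  x \in P -> y \in P -> x != y -> (0 < diff_mult P (x - y)%R)%N.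
Proof.
move=> xP yP xy; rewrite card_gt0; apply/set0Pn; exists (x, y).
by rewrite !inE /= xP yP xy eqxx.
Qed.

Section PartialDifferenceSet.

Variables (F : finFieldType) (q k lambda mu : nat) (P : {set F}).
Hypothesis P0 : 0 \notin P.
Hypothesis P_pds : partial_difference_set q k lambda mu P.

(** The sum of all multiplicities splits over [P], over [0], which contributes nothing, and over the
    [q - k.+1] remaining elements. *)
Lemma pds_count : (k * lambda + (q - k.+1) * mu + k = k * k)%N.
Proof.
have [cardF cardP Plam Pmu] := P_pds.
rewrite -cardP -sum_diff_mult; congr addn.
rewrite (bigID (mem P)) /=; congr addn.
  by rewrite (eq_bigr (fun=> lambda)) ?sum_nat_const // => d /Plam.
rewrite (bigD1 0) //= diff_mult0 add0n.
rewrite (eq_bigr (fun=> mu)); last first.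
  by move=> d dP; apply: Pmu; rewrite !inE negb_or.
rewrite sum_nat_const; congr muln.
have -> : #|[pred d | (d \notin P) && (d != 0)]| = #|~: (0 |: P)|.
  by apply: eq_card => d; rewrite !inE negb_or andbC.
by rewrite cardsCs setCK cardsU1 P0 cardF.
Qed.

(** If [- x] fell outside [P], the common multiplicity of [x] and [- x] would be both [lambda] and
    [mu]. *)
Lemma proper_pds_opp : lambda <> mu -> forall x, x \in P -> - x \in P.
Proof.
have [_ _ Plam Pmu] := P_pds => neq x xP; apply: contra_notT neq => NxP.
rewrite -(Plam _ xP) -diff_multN; apply: Pmu.
rewrite !inE negb_or NxP oppr_eq0.
by apply: contraNneq P0 => <-.
Qed.

Lemma pds_mu0_sub : mu = 0%N ->
  forall x y, x \in P -> y \in P -> x != y -> x - y \in P.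
Proof.
have [_ _ _ Pmu] := P_pds => mu0 x y xP yP xy; apply: contraTT isT => dP.
have := diff_mult_gt0 xP yP xy.
by rewrite Pmu ?mu0 // !inE negb_or dP subr_eq0.
Qed.

Lemma proper_pds_lambda0_mu1_card :
  lambda = 0%N -> mu = 1%N -> (k <= 2)%N.
Proof.
have [_ cardP Plam Pmu] := P_pds => lam0 mu1.
have PN : forall x, x \in P -> - x \in P.
  by apply: proper_pds_opp; rewrite lam0 mu1.
have [Pempty|[x xP]] := set_0Vmem P; first by rewrite -cardP Pempty cards0.
suff /subset_leq_card : P \subset [set x; - x].
  by rewrite cardP => /leq_trans; apply; rewrite cards2; case: (_ == _).
apply/subsetP => y yP; rewrite !inE.
apply/negPn/negP; rewrite negb_or => /andP[yx yNx].
have xy : x != y by rewrite eq_sym.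
have dP : x - y \notin P.
  apply/negP => /Plam; rewrite lam0 => d0.
  by have := diff_mult_gt0 xP yP xy; rewrite d0.
have /eqP : diff_mult P (x - y) = 1%N.
  by rewrite Pmu // !inE negb_or dP subr_eq0.
move=> /cards1P[z defz].
have : (x, y) \in [set z] by rewrite -defz !inE /= xP yP xy eqxx.
(* A second pair with difference [x - y]; it coincides with [(x, y)] only if [y = - x]. *)
have : (- y, - x) \in [set z].
  rewrite -defz !inE /= !PN // eqr_opp yx /= opprK addrC.
  by rewrite eqxx.
rewrite !inE => /eqP <- /eqP[_ yE].
by rewrite yE eqxx in yNx.
Qed.

End PartialDifferenceSet.

Section UnitGroup.

Variables (F : finFieldType) (G : {group {unit F}}).
Let P : {set F} := [set FinRing.uval u | u in G].

Lemma unit_group_neq0 : 0 \notin P.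
Proof.
apply/imsetP => -[u _ u0].
by have := valP u; rewrite /= -u0 unitr0.
Qed.

Lemma unit_group_divring_closed :
  (1 < #|P|)%N ->
  (forall x y, x \in P -> y \in P -> x != y -> x - y \in P) ->
  is_subfield (P :|: [set 0]).
Proof.
move=> cardP Psub.
have neq0 x : x \in P -> x != 0.
  by move=> xP; apply: contraNneq unit_group_neq0 => <-.
(* Since [0] is not in [P], [- y] is reached by two subtractions inside [P]: take [x] in [P] other
   than [y] and write [- y = (x - y) - x], where [x - y != x] because [y != 0]. *)
have PN y : y \in P -> - y \in P.
  move=> yP; have := cardP; rewrite (cardsD1 y) yP add1n ltnS card_gt0.
  case/set0Pn => x; rewrite !inE => /andP[xy xP].
  have -> : - y = x - y - x by rewrite addrAC subrr add0r.
  apply: (Psub _ _ (Psub _ _ xP yP xy) xP).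
  by rewrite -subr_eq0 addrAC subrr add0r oppr_eq0 neq0.
have Pdiv x y : x \in P -> y \in P -> x / y \in P.
  case/imsetP => u uG ->; case/imsetP => v vG ->; apply/imsetP.
  by exists (u * v^-1)%g; rewrite ?groupM ?groupV.
split.
- by rewrite !inE; apply/orP; left; apply/imsetP; exists 1%g.
- move=> x y; rewrite !inE => /orP[xP|/eqP->] /orP[yP|/eqP->].
  + by rewrite subr_eq0; have [->|xy] := eqVneq x y; rewrite ?orbT ?Psub.
  + by rewrite subr0 xP.
  + by rewrite sub0r PN.
  + by rewrite subrr eqxx orbT.
- move=> x y; rewrite !inE => /orP[xP|/eqP->] /orP[yP|/eqP->].
  + by rewrite Pdiv.
  + by rewrite invr0 mulr0 eqxx orbT.
  + by rewrite mul0r eqxx orbT.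
  + by rewrite mul0r eqxx orbT.
Qed.

End UnitGroup.

(** For [x] outside [S], the elements [1] and [x] are linearly independent over [S], so the
    combinations [a + b * x] with [a], [b] in [S] are pairwise distinct. *)
Lemma proper_subfield_card (F : finFieldType) (S : {set F}) :
  is_subfield S -> (#|S| < #|F|)%N -> (#|S| * #|S| <= #|F|)%N.
Proof.
case=> S1 SB Sdiv ltSF.
have [x _ xS] : exists2 x, x \in [set: F] & x \notin S.
  by apply/subsetPn; apply/negP => /subset_leq_card; rewrite cardsT leqNgt ltSF.
rewrite -cardsX.
have comb_inj : {in setX S S &, injective (fun z : F * F => z.1 + z.2 * x)}.
  move=> [a b] [c d]; rewrite !inE /= => /andP[aS bS] /andP[cS dS] E.
  have E' : (b - d) * x = c - a.
    by apply/(addrI a); rewrite mulrBl addrA E addrK addrC subrK.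
  have bd : b = d.
    apply/eqP; rewrite -subr_eq0; apply: contraNT xS => bd0.
    have -> : x = (c - a) / (b - d) by rewrite -E' mulrC mulKf.
    by apply: Sdiv; apply: SB.
  by move: E; rewrite bd => /addIr ->.
by rewrite -(card_in_imset comb_inj) -cardsT subset_leq_card ?subsetT.
Qed.

Theorem theorem4p5 (F : finFieldType) (alpha : {unit F})
    (p beta q e f lambda mu : nat)
    (p_prime : prime p) (beta_gt0 : (0 < beta)%N)
    (card_F : #|F| = q)
    (q_def : q = (p ^ beta)%N) (q_ef : q = (e * f + 1)%N)
    (e_gt1 : (1 < e)%N) (f_gt1 : (1 < f)%N)
    (alpha_prim : primitive_element alpha)
    (C_pds : proper_partial_difference_set q f lambda mu
               (cyclotomic_class0 alpha e)) :
  [/\ (f < e)%N -> is_subfield (cyclotomic_class0 alpha e :|: [set 0]),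
      (e < f)%N -> ~ is_subfield (cyclotomic_class0 alpha e :|: [set 0])
                   /\ (1 <= mu)%N
    & (2 < f)%N -> e <> f].
Proof.
have [pds _] := C_pds; have [_ cardP _ _] := pds.
have P0 : 0 \notin cyclotomic_class0 alpha e := unit_group_neq0 _.
(* This is [pds_count] with the common factor [f] cancelled. *)
have count : (lambda + e.-1 * mu + 1 = f)%N.
  have := pds_count P0 pds; rewrite q_ef.
  have -> : (e * f + 1 - f.+1 = f * e.-1)%N by nia.
  by move=> E; apply/eqP; rewrite -(eqn_pmul2l (ltnW f_gt1)) -E; apply/eqP; nia.
have mu0_subfield : mu = 0%N ->
    is_subfield (cyclotomic_class0 alpha e :|: [set 0]).
  move=> mu0; apply: unit_group_divring_closed; first by rewrite [#|_|]cardP.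
  exact: (pds_mu0_sub pds mu0).
have subfield_lt : is_subfield (cyclotomic_class0 alpha e :|: [set 0]) ->
    (f < e)%N.
  move=> /proper_subfield_card.
  (* The subfield is proper because [e > 1], and [(f + 1)^2 <= e * f + 1] gives [f + 2 <= e]. *)
  rewrite setUC cardsU1 P0 cardP card_F q_ef; nia.
split.
(* A positive [mu] would make the left side of [count] at least [e], which exceeds [f]. *)
- by move=> lt_fe; apply: mu0_subfield; nia.
- move=> lt_ef; split=> [/subfield_lt|]; first by lia.
  by case: (posnP mu) => // /mu0_subfield/subfield_lt; lia.
- move=> f_gt2 eq_ef.
  have [/mu0_subfield/subfield_lt|mu_gt0] := posnP mu; first by lia.
  have mu1 : mu = 1%N by nia.
  have lam0 : lambda = 0%N by nia.
  by have := proper_pds_lambda0_mu1_card P0 pds lam0 mu1; lia.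
Qed.
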